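(* Let $\theta$ be an ATL-formula and let $\mathcal{M}=(\Sigma,S,d,\delta,AP,L)$ be a CGM satisfying $\theta$ (at some state). Define $L^+_{\mathcal M}(s)=\{\varphi : \mathcal{M},s\Vdash\varphi\}$, where $\varphi$ ranges over all ATL-formulae. Then $(\Sigma,S,d,\delta,L^+_{\mathcal M})$ is a (perfect-recall) concurrent game Hintikka structure for $\theta$.
   Context: ATL-formulae over a set AP of atoms and a finite non-empty agent set $\Sigma$: $\varphi ::= p \mid \neg\varphi \mid (\varphi_1\to\varphi_2)\mid \langle\langle A\rangle\rangle\bigcirc\varphi \mid \langle\langle A\rangle\rangle\Box\varphi \mid \langle\langle A\rangle\rangle \varphi_1\,\mathcal{U}\,\varphi_2$, $A\subseteq\Sigma$; $\wedge$, $\top$ defined as usual. A concurrent game frame (CGF) is $(\Sigma,S,d,\delta)$ with $S\ne\emptyset$, $d_a(s)\ge1$ moves $D_a(s)=\{0,\dots,d_a(s)-1\}$ for agent $a$ at $s$, move vectors $D(s)=\prod_a D_a(s)$, and $\delta(s,\sigma)\in S$; a CGM additionally has $AP$ and $L:S\to\mathcal P(AP)$. An $A$-move $\sigma_A$ at $s$ picks a move for each $a\in A$; $out(s,\sigma_A)=\{\delta(s,\sigma):\sigma\in D(s)\text{ agrees with }\sigma_A\text{ on }A\}$. A co-$A$-move at $s$ is a function $c$ from $A$-moves at $s$ to $D(s)$ with $c(\sigma_A)$ agreeing with $\sigma_A$ on $A$; $out(s,c)=\{\delta(s,c(\sigma_A)):\sigma_A\text{ an }A\text{-move at }s\}$.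 A run is an infinite sequence of states each a $\delta$-successor of the previous one. A perfect-recall $A$-strategy (resp. co-$A$-strategy) $F$ maps each non-empty finite sequence of states ending at $t$ to an $A$-move (resp. co-$A$-move) at $t$; $out(s,F)$ is the set of runs $\lambda$ with $\lambda[0]=s$ and $\lambda[i+1]\in out(\lambda[i],F(\lambda[0],\dots,\lambda[i]))$ for all $i$. Satisfaction $\Vdash$ in a CGM: $s\Vdash p$ iff $p\in L(s)$; Boolean clauses usual; $s\Vdash\langle\langle A\rangle\rangle\bigcirc\varphi$ iff some $A$-move at $s$ has $\varphi$ true throughout its outcome; $s\Vdash\langle\langle A\rangle\rangle\Box\varphi$ iff some perfect-recall $A$-strategy $F$ has $\varphi$ true at every position of every $\lambda\in out(s,F)$; $s\Vdash\langle\langle A\rangle\rangle\varphi\,\mathcal U\,\psi$ iff some perfect-recall $A$-strategy $F$ ensures each $\lambda\in out(s,F)$ has $i$ with $\psi$ at $\lambda[i]$ and $\varphi$ at $\lambda[j]$ for $j<i$. $\alpha$-formulae and components: $\neg\neg\varphi$ ($\varphi,\varphi$); $\neg(\varphi\to\psi)$ ($\varphi,\neg\psi$); $\neg\langle\langle\Sigma\rangle\rangle\bigcirc\varphi$ ($\langle\langle\emptyset\rangle\rangle\bigcirc\neg\varphi$ twice); $\langle\langle A\rangle\rangle\Box\varphi$ ($\varphi$, $\langle\langle A\rangle\rangle\bigcirc\langle\langle A\rangle\rangle\Box\varphi$). $\beta$-formulae and components: $\varphi\to\psi$ ($\neg\varphi$, $\psi$); $\langle\langle A\rangle\rangle\varphi\,\mathcal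 U\,\psi$ ($\psi$, $\varphi\wedge\langle\langle A\rangle\rangle\bigcirc\langle\langle A\rangle\rangle\varphi\,\mathcal U\,\psi$); $\neg\langle\langle A\rangle\rangle\varphi\,\mathcal U\,\psi$ ($\neg\psi\wedge\neg\varphi$, $\neg\psi\wedge\neg\langle\langle A\rangle\rangle\bigcirc\langle\langle A\rangle\rangle\varphi\,\mathcal U\,\psi$); $\neg\langle\langle A\rangle\rangle\Box\varphi$ ($\neg\varphi$, $\neg\langle\langle A\rangle\rangle\bigcirc\langle\langle A\rangle\rangle\Box\varphi$). A (perfect-recall) concurrent game Hintikka structure (CGHS) is $(\Sigma,S,d,\delta,H)$ where $(\Sigma,S,d,\delta)$ is a CGF and $H$ labels each $s\in S$ with a set of ATL-formulae such that: (H1) if $\neg\varphi\in H(s)$ then $\varphi\notin H(s)$; (H2) if $\alpha\in H(s)$ then $\alpha_1,\alpha_2\in H(s)$; (H3) if $\beta\in H(s)$ then $\beta_1\in H(s)$ or $\beta_2\in H(s)$; (H4) if $\langle\langle A\rangle\rangle\bigcirc\varphi\in H(s)$ there is an $A$-move $\sigma_A$ at $s$ with $\varphi\in H(s')$ for all $s'\in out(s,\sigma_A)$; (H5) if $\neg\langle\langle A\rangle\rangle\bigcirc\varphi\in H(s)$ there is a co-$A$-move $c$ at $s$ with $\neg\varphi\in H(s')$ for all $s'\in out(s,c)$; (H6) if $\langle\langle A\rangle\rangle\varphi\,\mathcal U\,\psi\in H(s)$ there is a perfect-recall $A$-strategy $F$ such that every $\lambda\in out(s,F)$ has $i\ge0$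 with $\psi\in H(\lambda[i])$ and $\varphi\in H(\lambda[j])$ for all $j<i$; (H7) if $\neg\langle\langle A\rangle\rangle\Box\varphi\in H(s)$ there is a perfect-recall co-$A$-strategy $F$ such that every $\lambda\in out(s,F)$ has $i\ge0$ with $\neg\varphi\in H(\lambda[i])$. It is a CGHS for $\theta$ if $\theta\in H(s)$ for some $s\in S$. *)

(* Defs.v *)
From mathcomp Require Import all_boot.

Set Implicit Arguments.
Unset Strict Implicit.
Unset Printing Implicit Defensive.

(* Sets of states, atoms and formulae are Prop-valued predicates, since they
   need be neither finite nor decidable. *)

Inductive formula (Sigma : finType) (AP : Type) : Type :=
| Atom of AP
| Neg of formula Sigma AP
| Imp of formula Sigma AP & formula Sigma AP
| Next of {set Sigma} & formula Sigma AP
| Always of {set Sigma} & formula Sigma AP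
| Until of {set Sigma} & formula Sigma AP & formula Sigma AP.

Arguments Atom {Sigma AP} p.

Definition And (Sigma : finType) (AP : Type) (phi psi : formula Sigma AP) :
    formula Sigma AP :=
  Neg (Imp phi (Neg psi)).

Record cgf (Sigma : finType) := CGF {
  state : Type;
  state_inhabited : inhabited state;
  nmoves : Sigma -> state -> nat;
  nmoves_gt0 : forall a s, 0 < nmoves a s;
  delta : forall s : state, {dffun forall a : Sigma, 'I_(nmoves a s)} -> state
}.

Record cgm (Sigma : finType) (AP : Type) := CGM {
  cgm_frame :> cgf Sigma;
  cgm_label : state cgm_frame -> AP -> Prop
}.

Section Frame.

Variables (Sigma : finType) (G : cgf Sigma).
Implicit Types (A : {set Sigma}) (s t : state G) (lam : nat -> state G).

Definition move_vector s : Type := {dffun forall a : Sigma, 'I_(nmoves a s)}.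

Definition amove A s : Type :=
  {dffun forall a : {a : Sigma | a \in A}, 'I_(nmoves (val a) s)}.

Definition agrees A s (sA : amove A s) (sigma : move_vector s) : Prop :=
  forall a : {a : Sigma | a \in A}, sigma (val a) = sA a.

Definition comove A s : Type :=
  {c : amove A s -> move_vector s | forall sA, agrees sA (c sA)}.

Definition out A s (sA : amove A s) (s' : state G) : Prop :=
  exists2 sigma : move_vector s, agrees sA sigma & s' = delta sigma.

Definition co_out A s (c : comove A s) (s' : state G) : Prop :=
  exists sA : amove A s, s' = delta (sval c sA).

Definition run lam : Prop :=
  forall i, exists sigma : move_vector (lam i), lam i.+1 = delta sigma.

(* A non-empty finite sequence of states is presented as the pair of its last
   element t and the (possibly empty) sequence h preceding it. *)
Definition strategy A : Type := forall (h : seq (state G)) (t : state G), amove A t.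

Definition costrategy A : Type :=
  forall (h : seq (state G)) (t : state G), comove A t.

(* mkseq lam i is lam 0, ..., lam (i - 1). *)
Definition strat_out s A (F : strategy A) lam : Prop :=
  [/\ run lam, lam 0 = s & forall i, out (F (mkseq lam i) (lam i)) (lam i.+1)].

Definition costrat_out s A (F : costrategy A) lam : Prop :=
  [/\ run lam, lam 0 = s
    & forall i, co_out (F (mkseq lam i) (lam i)) (lam i.+1)].

End Frame.

Fixpoint sat (Sigma : finType) (AP : Type) (M : cgm Sigma AP) (s : state M)
    (phi : formula Sigma AP) {struct phi} : Prop :=
  match phi with
  | Atom p => cgm_label s p
  | Neg f => ~ sat s f
  | Imp f g => sat s f -> sat s g
  | Next A f => exists sA : amove A s, forall s', out sA s' -> sat s' f
  | Always A f =>
      exists F : strategy M A,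
        forall lam, strat_out s F lam -> forall i, sat (lam i) f
  | Until A f g =>
      exists F : strategy M A,
        forall lam, strat_out s F lam ->
          exists i, sat (lam i) g /\ (forall j, j < i -> sat (lam j) f)
  end.

(* alpha phi phi1 phi2: phi is an alpha-formula with components phi1, phi2. *)
Inductive alpha (Sigma : finType) (AP : Type) :
    formula Sigma AP -> formula Sigma AP -> formula Sigma AP -> Prop :=
| alpha_negneg phi : alpha (Neg (Neg phi)) phi phi
| alpha_negimp phi psi : alpha (Neg (Imp phi psi)) phi (Neg psi)
| alpha_negnext phi :
    alpha (Neg (Next [set: Sigma] phi))
      (Next set0 (Neg phi)) (Next set0 (Neg phi))
| alpha_always A phi :
    alpha (Always A phi) phi (Next A (Always A phi)).

Inductive beta (Sigma : finType) (AP : Type) :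
    formula Sigma AP -> formula Sigma AP -> formula Sigma AP -> Prop :=
| beta_imp phi psi : beta (Imp phi psi) (Neg phi) psi
| beta_until A phi psi :
    beta (Until A phi psi) psi (And phi (Next A (Until A phi psi)))
| beta_neguntil A phi psi :
    beta (Neg (Until A phi psi))
      (And (Neg psi) (Neg phi))
      (And (Neg psi) (Neg (Next A (Until A phi psi))))
| beta_negalways A phi :
    beta (Neg (Always A phi)) (Neg phi) (Neg (Next A (Always A phi))).

Record is_cghs (Sigma : finType) (AP : Type) (G : cgf Sigma)
    (H : state G -> formula Sigma AP -> Prop) : Prop := IsCGHS {
  cghs_H1 : forall s phi, H s (Neg phi) -> ~ H s phi;
  cghs_H2 : forall s phi phi1 phi2,
    alpha phi phi1 phi2 -> H s phi -> H s phi1 /\ H s phi2;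
  cghs_H3 : forall s phi phi1 phi2,
    beta phi phi1 phi2 -> H s phi -> H s phi1 \/ H s phi2;
  cghs_H4 : forall s A phi, H s (Next A phi) ->
    exists sA : amove A s, forall s', out sA s' -> H s' phi;
  cghs_H5 : forall s A phi, H s (Neg (Next A phi)) ->
    exists c : comove A s, forall s', co_out c s' -> H s' (Neg phi);
  cghs_H6 : forall s A phi psi, H s (Until A phi psi) ->
    exists F : strategy G A, forall lam, strat_out s F lam ->
      exists i, H (lam i) psi /\ (forall j, j < i -> H (lam j) phi);
  cghs_H7 : forall s A phi, H s (Neg (Always A phi)) ->
    exists F : costrategy G A, forall lam, costrat_out s F lam ->
      exists i, H (lam i) (Neg phi)
}.

Definition is_cghs_for (Sigma : finType) (AP : Type) (theta : formula Sigma AP)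
    (G : cgf Sigma) (H : state G -> formula Sigma AP -> Prop) : Prop :=
  is_cghs H /\ exists s, H s theta.

Definition extended_label (Sigma : finType) (AP : Type) (M : cgm Sigma AP) :
    state M -> formula Sigma AP -> Prop :=
  fun s phi => sat s phi.

(* Main.v *)
Require Import Defs.
From mathcomp Require Import all_boot boolp.

(** A strategy amounts to a first move together with a strategy from each of its
    outcomes; this gives the fixed-point clauses (H2) and (H3).  The substantial
    clause (H7) is the determinacy of the safety game in which A must avoid P.
    Let the attractor of rank n be the states from which the opponents,
    answering each A-move, reach P within n rounds.  Since a state has only
    finitely many A-moves, outside all ranks there is a single A-move that avoids
    all of them at once, so A can stay outside forever.  Hence if A cannot avoid
    P, the state has a finite rank, and the opponents win by counting down. *)

Set Implicit Arguments.
Unset Strict Implicit.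
Unset Printing Implicit Defensive.

(** * Moves, outcomes and co-moves *)

Section Moves.

Variables (Sigma : finType) (G : cgf Sigma).
Implicit Types (A : {set Sigma}) (s t : state G).

Definition zero_amove A s : amove A s :=
  [ffun a => Ordinal (nmoves_gt0 (val a) s)].

Lemma agrees_extension A s (sA : amove A s) : exists sigma, agrees sA sigma.
Proof.
have ext a : exists v : 'I_(nmoves a s),
    forall aA : a \in A, v = sA (exist _ a aA).
  have [aA|aNA] := pselect (a \in A).
    by exists (sA (exist _ a aA)) => aA'; rewrite (bool_irrelevance aA' aA).
  by exists (Ordinal (nmoves_gt0 a s)).
exists [ffun a => sval (cid (ext a))] => -[a aA].
by rewrite ffunE /=; case: cid => /= v ->.
Qed.

Lemma out_inhabited A s (sA : amove A s) : exists s', out sA s'.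
Proof.
by have [sigma] := agrees_extension sA; exists (delta sigma); exists sigma.
Qed.

Lemma out_delta A s (sA : amove A s) s' :
  out sA s' -> exists sigma : move_vector s, s' = delta sigma.
Proof. by case=> sigma _ ->; exists sigma. Qed.

Lemma out_setT s (sA : amove [set: Sigma] s) (sigma : move_vector s) s' :
  agrees sA sigma -> out sA s' -> s' = delta sigma.
Proof.
move=> ag [tau ag' ->]; congr delta; apply/ffunP => a.
have aT := in_setT a.
by move: (ag (exist _ a aT)) (ag' (exist _ a aT)) => /= -> ->.
Qed.

Lemma agrees_restriction A s (sigma : move_vector s) :
  exists sA : amove A s, agrees sA sigma.
Proof. by exists [ffun a => sigma (val a)] => a; rewrite ffunE. Qed.

(** Choosing one good reply per A-move assembles a co-A-move. This yields (H5) and each single round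
    of the opponents' strategy for (H7). *)
Lemma comove_exists A s (P : state G -> Prop) :
  (forall sA : amove A s, exists2 s', out sA s' & P s') ->
  exists c : comove A s, forall s', co_out c s' -> P s'.
Proof.
move=> win.
have answer (sA : amove A s) :
    exists sigma : move_vector s, agrees sA sigma /\ P (delta sigma).
  by have [_ [sigma ag ->] Ps] := win sA; exists sigma.
have [c cP] := choice answer.
exists (exist _ c (fun sA => (cP sA).1)) => _ [sA ->] /=.
exact: (cP sA).2.
Qed.

Lemma comove_inhabited A s : exists c : comove A s, True.
Proof.
have [|c _] := @comove_exists A s (fun=> True); last by exists c.
by move=> sA; have [s'] := out_inhabited sA; exists s'.
Qed.

End Moves.

(** * Objectives enforced by a coalition; determinacy of safety games *)

Section Enforcement.

Variables (Sigma : finType) (G : cgf Sigma) (A : {set Sigma}).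
Implicit Types (s t : state G) (lam : nat -> state G).
Implicit Types (W : (nat -> state G) -> Prop) (P : state G -> Prop).

(** Satisfaction of [Always] and of [Until] are both convertible to instances of this, so one
    unfolding lemma serves both. *)
Definition enforces s W : Prop :=
  exists F : strategy G A, forall lam, strat_out s F lam -> W lam.

Lemma enforces_sub s W W' :
  (forall lam, lam 0 = s -> W lam -> W' lam) -> enforces s W -> enforces s W'.
Proof.
move=> WW' [F winF]; exists F => lam lamF.
by apply: WW'; [case: lamF | exact: winF].
Qed.

(** Excludes vacuous winning, so that an enforced objective gives information about [s] itself. The
    run is built by iterating a choice of outcome on pairs of history and current state. *)
Lemma strat_out_inhabited s (F : strategy G A) : exists lam, strat_out s F lam.
Proof.
have next ht : exists s', out (F ht.1 ht.2) s' by exact: out_inhabited.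
pose step ht := (rcons ht.1 ht.2, sval (cid (next ht))).
pose pos i := iter i step ([::], s).
pose lam i := (pos i).2.
have histE i : mkseq lam i = (pos i).1.
  by elim: i => // i IHi; rewrite mkseqS IHi.
have lam_out i : out (F (mkseq lam i) (lam i)) (lam i.+1).
  by rewrite histE; exact: (svalP (cid (next (pos i)))).
by exists lam; split=> // i; exact: out_delta (lam_out i).
Qed.

Lemma enforces_possible s W : enforces s W -> exists2 lam, lam 0 = s & W lam.
Proof.
move=> [F winF]; have [lam lamF] := strat_out_inhabited s F.
by exists lam; [case: lamF | exact: winF].
Qed.

Definition prepend s lam : nat -> state G :=
  fun i => if i is j.+1 then lam j else s.

Lemma prepend_tail lam : prepend (lam 0) (fun i => lam i.+1) = lam.
Proof. by apply/funext; case. Qed.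

Lemma mkseq_prepend s lam i : mkseq (prepend s lam) i.+1 = s :: mkseq lam i.
Proof. by rewrite /mkseq /= (iotaDl 1 0) -map_comp. Qed.

Lemma strat_out_prepend s (F : strategy G A) s' lam :
  out (F [::] s) s' -> strat_out s' (fun h t => F (s :: h) t) lam ->
  strat_out s F (prepend s lam).
Proof.
move=> ss' [lam_run lam0 lam_out]; split=> // -[|i].
- by rewrite /= lam0; exact: out_delta ss'.
- exact: lam_run.
- by rewrite /= lam0.
- by rewrite mkseq_prepend; exact: lam_out.
Qed.

Lemma enforces_next s W :
  enforces s W <->
  exists sA : amove A s, forall s', out sA s' ->
    enforces s' (fun lam => W (prepend s lam)).
Proof.
split=> [[F winF]|[sA win]].
  exists (F [::] s) => s' ss'; exists (fun h t => F (s :: h) t) => lam lamF.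
  exact: winF (strat_out_prepend ss' lamF).
(* Strategies are total, so [first] and [rest] fall back on [zero_amove] where nothing is promised.
   The guard [t = s] lets the dependently typed [sA] serve at [t]. *)
have first t : exists tA : amove A t, t = s -> forall s', out tA s' ->
    enforces s' (fun lam => W (prepend s lam)).
  have [->|neq] := pselect (t = s); first by exists sA.
  by exists (zero_amove A t).
have rest s' : exists F : strategy G A,
    enforces s' (fun lam => W (prepend s lam)) ->
    forall lam, strat_out s' F lam -> W (prepend s lam).
  have [[F winF]|nowin] := pselect (enforces s' (fun lam => W (prepend s lam))).
    by exists F.
  by exists (fun _ t => zero_amove A t).
(* After the first round, [F] drops the initial state from the history and follows the strategy
   chosen for the second state of the run. That state is [head t h']: when [h'] is empty it is the
   current state [t]. *)
pose F (h : seq (state G)) t :=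
  if h is _ :: h' then sval (cid (rest (head t h'))) h' t
  else sval (cid (first t)).
exists F => lam [lam_run lam0 lam_out].
rewrite -(prepend_tail lam) lam0.
have win1 : enforces (lam 1) (fun mu => W (prepend s mu)).
  exact: (svalP (cid (first (lam 0))) lam0) (lam_out 0).
apply: (svalP (cid (rest (lam 1))) win1); split=> // i.
have := lam_out i.+1.
have -> : mkseq lam i.+1 = lam 0 :: mkseq (fun j => lam j.+1) i.
  by rewrite -mkseq_prepend prepend_tail.
rewrite /F.
by case: i.
Qed.

Fixpoint attractor P n s : Prop :=
  if n is m.+1 then
    P s \/ forall sA : amove A s, exists2 s', out sA s' & attractor P m s'
  else P s.

Lemma attractor_mono P m n s : m <= n -> attractor P m s -> attractor P n s.
Proof.
elim: m n s => [|m IHm] [|n] s //; first by left.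
rewrite ltnS => lemn [Ps|win]; [by left | right=> sA].
by have [s' ss' /(IHm _ _ lemn)] := win sA; exists s'.
Qed.

Lemma attractor_coenforces P n s :
  attractor P n s ->
  exists F : costrategy G A,
    forall lam, costrat_out s F lam -> exists i, P (lam i).
Proof.
move=> attr_s.
have answer m t : exists c : comove A t, attractor P m.+1 t ->
    P t \/ forall s', co_out c s' -> attractor P m s'.
  have [win|nowin] := pselect (forall sA : amove A t,
      exists2 s', out sA s' & attractor P m s').
    by have [c winc] := comove_exists win; exists c; right.
  by have [c _] := comove_inhabited A t; exists c => -[]; [left|].
(* The history length counts the rounds played: after [i] rounds the rank is [n - i], and for
   [i < n] the reply must lead to rank [n - i.+1]. *)
exists (fun h t => sval (cid (answer (n - (size h).+1) t))).
(* If [P] is never met, the rank falls every round and is 0 after [n] rounds, where [attractor] is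
   [P] itself. *)
move=> lam [_ lam0 lam_out]; apply: contrapT => /forallNP avoid.
suff attr_lam i : i <= n -> attractor P (n - i) (lam i).
  by apply: (avoid n); have := attr_lam n (leqnn n); rewrite subnn.
elim: i => [|i IHi] ltin; first by rewrite subn0 lam0.
have := IHi (ltnW ltin); rewrite -(subnSK ltin) => attr_i.
have := lam_out i; rewrite size_mkseq.
by case: (svalP (cid (answer (n - i.+1) (lam i))) attr_i) => [/avoid|]; last exact.
Qed.

Lemma avoid_attractor P s :
  (forall n, ~ attractor P n s) ->
  exists sA : amove A s, forall s', out sA s' -> forall n, ~ attractor P n s'.
Proof.
move=> safe; apply: contrapT => /forallNP hit.
have reach (sA : amove A s) : exists n, exists2 s', out sA s' & attractor P n s'.
  apply: contrapT => /forallNP noreach; apply: (hit sA) => s' ss' n attr.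
  by apply: (noreach n); exists s'.
have [rank rankP] := choice reach.
(* The A-moves at [s] form a finite type, so their ranks have a maximum; one more round puts [s] in
   the attractor. *)
apply: (safe (\max_sA rank sA).+1); right=> sA.
have [s' ss' attr] := rankP sA; exists s' => //.
exact: attractor_mono (leq_bigmax sA) attr.
Qed.

Lemma safety_determined P s :
  enforces s (fun lam => forall i, ~ P (lam i)) \/
  exists F : costrategy G A,
    forall lam, costrat_out s F lam -> exists i, P (lam i).
Proof.
have [[n /attractor_coenforces]|/forallNP safe_s] :=
  pselect (exists n, attractor P n s); [by right | left].
pose safe t := forall n, ~ attractor P n t.
have stay t : exists tA : amove A t, safe t -> forall s', out tA s' -> safe s'.
  have [/avoid_attractor [tA tAP]|unsafe] := pselect (safe t); first by exists tA.
  by exists (zero_amove A t).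
(* A memoryless strategy suffices: being outside all ranks is preserved, and rank 0 is [P]. *)
exists (fun _ t => sval (cid (stay t))) => lam [_ lam0 lam_out] i.
suff safe_i : safe (lam i) by exact: (safe_i 0).
elim: i => [|i IHi]; first by rewrite lam0.
exact: (svalP (cid (stay (lam i))) IHi) (lam_out i).
Qed.

End Enforcement.

(** * Fixed-point laws of satisfaction and the Hintikka clauses *)

Section Satisfaction.

Variables (Sigma : finType) (AP : Type) (M : cgm Sigma AP).
Implicit Types (A : {set Sigma}) (s : state M) (phi psi : formula Sigma AP).

Lemma sat_And s phi psi : sat s (And phi psi) <-> sat s phi /\ sat s psi.
Proof.
split=> [H|[Hphi Hpsi] /=]; last by apply.
by split; apply: contrapT => N; apply: H => /=.
Qed.

Lemma sat_Always s A phi :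
  sat s (Always A phi) <-> sat s phi /\ sat s (Next A (Always A phi)).
Proof.
pose W (lam : nat -> state M) := forall i, sat (lam i) phi.
rewrite -[sat s (Always A phi)]/(enforces A s W).
split=> [win|[phi_s [sA win]]].
  split; first by have [lam <- phi_lam] := enforces_possible win; exact: phi_lam.
  have [sA winA] := (enforces_next A s W).1 win.
  exists sA => s' /winA; apply: enforces_sub => lam _ phi_lam i.
  exact: phi_lam i.+1.
apply/enforces_next; exists sA => s' /win.
by apply: enforces_sub => lam _ phi_lam [|i] //; exact: phi_lam.
Qed.

Lemma sat_Until s A phi psi :
  sat s (Until A phi psi) <->
  sat s psi \/ sat s phi /\ sat s (Next A (Until A phi psi)).
Proof.
pose W (lam : nat -> state M) :=
  exists i, sat (lam i) psi /\ (forall j, j < i -> sat (lam j) phi).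
rewrite -[sat s (Until A phi psi)]/(enforces A s W).
(* If [psi] holds at [s], any strategy wins at position 0; otherwise the witnessing position is
   positive and shifts down to the tail of the run. *)
have [psi_s|npsi_s] := pselect (sat s psi).
  split=> [_|_]; first by left.
  by exists (fun _ t => zero_amove A t) => lam [_ lam0 _]; exists 0; rewrite lam0.
split=> [win|[//|[phi_s [sA win]]]].
  right; split.
    have [lam lam0 [[|i] [psi_i phi_lt]]] := enforces_possible win.
      by rewrite lam0 in psi_i.
    by rewrite -lam0; exact: phi_lt.
  have [sA winA] := (enforces_next A s W).1 win.
  exists sA => s' /winA; apply: enforces_sub => lam _ [[|i] [psi_i phi_lt]] //.
  by exists i; split=> // j ltji; exact: (phi_lt j.+1).
apply/enforces_next; exists sA => s' /win.
apply: enforces_sub => lam _ [i [psi_i phi_lt]].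
by exists i.+1; split=> // -[|j] //; exact: phi_lt.
Qed.

Lemma not_sat_Next s A phi :
  ~ sat s (Next A phi) ->
  forall sA : amove A s, exists2 s', out sA s' & ~ sat s' phi.
Proof.
move=> /= nonext sA; apply: contrapT => nowin; apply: nonext.
exists sA => s' ss'; apply: contrapT => nphi; apply: nowin; by exists s'.
Qed.

Lemma sat_alpha s phi phi1 phi2 :
  alpha phi phi1 phi2 -> sat s phi -> sat s phi1 /\ sat s phi2.
Proof.
case=> {phi phi1 phi2} [phi|phi psi|phi|A phi].
- by move=> /contrapT.
- by move=> /= /not_implyP.
- move=> /not_sat_Next nonext.
  suff: sat s (Next set0 (Neg phi)) by [].
  (* The empty coalition restricts nothing, so any [sigma] may occur; its restriction to all agents
     is a move whose only outcome is [delta sigma]. *)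
  exists (zero_amove set0 s) => _ [sigma _ ->].
  have [sA ag] := agrees_restriction [set: Sigma] sigma.
  by have [s' /(out_setT ag) ->] := nonext sA.
- by move/sat_Always.
Qed.

Lemma sat_beta s phi phi1 phi2 :
  beta phi phi1 phi2 -> sat s phi -> sat s phi1 \/ sat s phi2.
Proof.
case=> {phi phi1 phi2} [phi psi|A phi psi|A phi psi|A phi].
- by move=> /= imp; have [/imp|] := pselect (sat s phi); [right | left].
- by move=> /sat_Until [|/sat_And]; [left | right].
- rewrite !sat_And => nuntil.
  have npsi : ~ sat s psi by move=> ?; apply: nuntil; apply/sat_Until; left.
  have [phi_s|] := pselect (sat s phi); last by left.
  by right; split=> // next; apply: nuntil; apply/sat_Until; right.
- move=> nalways; have [phi_s|] := pselect (sat s phi); last by left.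
  by right=> next; apply: nalways; apply/sat_Always.
Qed.

End Satisfaction.

Theorem mainTheorem4 (Sigma : finType) (Sigma_nonempty : 0 < #|Sigma|)
    (AP : Type) (theta : formula Sigma AP) (M : cgm Sigma AP)
    (theta_sat : exists s : state M, sat s theta) :
  is_cghs_for theta (@extended_label Sigma AP M).
Proof.
(* (H1), (H4) and (H6) are clauses of [sat] verbatim; (H2), (H3), (H5) and (H7) remain. *)
split=> //; split=> //.
- by move=> s phi phi1 phi2 /sat_alpha; apply.
- by move=> s phi phi1 phi2 /sat_beta; apply.
- by move=> s A phi /not_sat_Next /comove_exists.
- move=> s A phi nalways.
  (* The opponents aim at a state refuting [phi]; if A can avoid all of these, double negation gives
     [Always A phi] at [s]. *)
  have [win|//] := safety_determined A (fun t => ~ sat t phi) s.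
  case: nalways; apply: enforces_sub win => lam _ win i.
  exact: contrapT (win i).
Qed.
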